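(* Let $c \in \mathbb{Z} \setminus \{0\}$, let $f_c(x) = x^2 + c$, and let $L_c$ be the splitting field over $\mathbb{Q}$ of the second iterate $f_c(f_c(x)) = (x^2+c)^2 + c$. Then $L_c$ is wildly ramified at $2$; that is, writing $2\mathcal{O}_{L_c} = \prod_{i=1}^g \mathfrak{p}_i^{e}$, the ramification index $e$ is divisible by $2$.
   Context: $\mathcal{O}_{L_c}$ denotes the ring of integers of $L_c$. Since $L_c/\mathbb{Q}$ is Galois, all primes $\mathfrak{p}_i$ of $\mathcal{O}_{L_c}$ above $2$ have a common ramification index $e$ and a common residue degree $f$, and $efg = [L_c:\mathbb{Q}]$. *)

(* Defs.v *)
From HB Require Import structures.
From mathcomp Require Import all_boot all_order all_algebra all_field.
Set Implicit Arguments. Unset Strict Implicit. Unset Printing Implicit Defensive.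
Import Order.TTheory GRing.Theory Num.Theory.
Local Open Scope ring_scope.

Definition fc (c : int) : {poly rat} := 'X^2 + (c%:~R : rat)%:P.
Definition fc2 (c : int) : {poly rat} := fc c \Po fc c.

Section RingOfIntegers.
Variables (L : fieldExtType rat) (E : {vspace L}).

Definition in_OE (x : L) : Prop :=
  x \in E /\ exists p : {poly int}, p \is monic /\ root (map_poly intr p) x.

Definition is_ideal (I : L -> Prop) : Prop :=
  (forall x, I x -> in_OE x) /\ I 0 /\
  (forall x y, I x -> I y -> I (x + y)) /\
  (forall a x, in_OE a -> I x -> I (a * x)).

Definition is_prime_ideal (P : L -> Prop) : Prop :=
  is_ideal P /\ ~ P 1 /\
  (forall a b, in_OE a -> in_OE b -> P (a * b) -> P a \/ P b).

Definition ideal_mul (I J : L -> Prop) : L -> Prop := fun x =>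
  exists s : seq (L * L),
    (forall ab, ab \in s -> I ab.1 /\ J ab.2) /\ x = \sum_(ab <- s) ab.1 * ab.2.

Fixpoint ideal_pow (P : L -> Prop) (k : nat) : L -> Prop :=
  match k with
  | 0 => in_OE
  | k'.+1 => ideal_mul P (ideal_pow P k')
  end.

(* e is the ramification index of P over 2: 2 O_E ⊆ P^e but not ⊆ P^(e+1) *)
Definition ram_index_2 (P : L -> Prop) (e : nat) : Prop :=
  ideal_pow P e 2 /\ ~ ideal_pow P e.+1 2.

End RingOfIntegers.

(* Main.v *)
(** Put d = -c, r = sqrt d, al^2 = d + r and be^2 = d - r.  For every prime P
    above 2 there are integers x and a of the field with x^2 = 2 a and a outside
    P, so that v_P(2) = 2 v_P(x) is even:
    - if d = 2 mod 4, take x = r;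
    - if t^2 = 3 mod 4, then (1 + t)^2 = 2 ((1 + t^2)/2 + t); this applies to
      t = r if d = 3 mod 4, and to t = al be / r, with t^2 = d - 1, if 4 | d;
    - if d = 4 m + 1, then w = (1 + r)/2 is integral, al^2 = 2 (w + 2 m) and
      be^2 = 2 (1 - w + 2 m), and P does not contain both w and 1 - w.
    The valuation v_P is handled through an element y with y P contained in O
    but y not in O: if y pi is outside P for some pi in P, then P^n consists of
    the z in O with z y^n in O.  The existence of such y and pi rests on the
    finiteness of O/2O. *)

Require Import Defs.
From HB Require Import structures.
From mathcomp Require Import all_boot all_order all_algebra all_field.
From mathcomp Require Import ring zify.
From Stdlib Require Import Classical.
Import GRing.Theory Num.Theory.
Local Open Scope ring_scope.

(** * Arithmetic in the ring of integers O of E *)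

Section IntegerRing.
Variables (L : fieldExtType rat) (E : {subfield L}).
Local Notation OE := (in_OE E).

Lemma ext_rat_neq0 (n : nat) : n.+1%:R != 0 :> L.
Proof. by rewrite -(rmorph_nat (in_alg L)) fmorph_eq0 pnatr_eq0. Qed.

Lemma in_OEP (x : L) : OE x <-> x \in E /\ integralOver (intr : int -> L) x.
Proof.
split=> -[xE]; first by case=> p [pm px]; split=> //; exists p.
by case=> p pm px; split=> //; exists p.
Qed.

Lemma OE_int (k : int) : OE k%:~R.
Proof. by apply/in_OEP; split; [exact: rpred_int | exact: (integral_id intr)]. Qed.

Lemma OE_eq (x y : L) : OE x -> x = y -> OE y.
Proof. by move=> xO <-. Qed.

Lemma OE0 : OE 0. Proof. exact: (OE_int 0). Qed.
Lemma OE1 : OE 1. Proof. exact: (OE_int 1). Qed.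

Lemma OED (x y : L) : OE x -> OE y -> OE (x + y).
Proof.
move=> /in_OEP[xE xi] /in_OEP[yE yi]; apply/in_OEP.
by split; [exact: rpredD | exact: integral_add].
Qed.

Lemma OEB (x y : L) : OE x -> OE y -> OE (x - y).
Proof.
move=> /in_OEP[xE xi] /in_OEP[yE yi]; apply/in_OEP.
by split; [exact: rpredB | exact: integral_sub].
Qed.

Lemma OEM (x y : L) : OE x -> OE y -> OE (x * y).
Proof.
move=> /in_OEP[xE xi] /in_OEP[yE yi]; apply/in_OEP.
by split; [exact: rpredM | exact: integral_mul].
Qed.

Lemma OEX (x : L) (n : nat) : OE x -> OE (x ^+ n).
Proof.
by move=> xO; elim: n => [|n IH]; rewrite ?expr0 ?exprS; [exact: OE1 | exact: OEM].
Qed.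

(* O is integrally closed, for monic equations of the shape x^n = b x^m + o. *)
Lemma OE_closed (x b o : L) (n m : nat) : x \in E -> OE b -> OE o ->
  (m < n)%N -> x ^+ n = b * x ^+ m + o -> OE x.
Proof.
move=> xE /in_OEP[_ bi] /in_OEP[_ oi] mn ex; apply/in_OEP; split=> //.
pose q : {poly L} := b *: 'X^m + o%:P.
have sq : (size q < size ('X^n : {poly L})%R)%N.
  rewrite size_polyXn ltnS (leq_trans (size_polyD _ _)) // geq_max.
  rewrite (leq_trans (size_scale_leq _ _)) ?size_polyXn //=.
  by rewrite (leq_trans (size_polyC_leq1 _)) // (leq_ltn_trans _ mn).
apply: (@integral_root_monic _ _ _ _ ('X^n - q)).
- by rewrite monicE lead_coefDl ?size_polyN // lead_coefXn.
- by rewrite rootE /q !hornerE ex subrr.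
apply/integral_poly => i.
rewrite coefB /q coefD coefZ !coefXn coefC.
apply: integral_sub; first exact: integral_nat.
apply: integral_add; first by apply: integral_mul => //; exact: integral_nat.
by case: ifP => _ //; exact: integral0.
Qed.

Lemma OE_sqr (x : L) : x \in E -> OE (x ^+ 2) -> OE x.
Proof. by move=> xE x2; apply: (OE_closed _ 0 _ 2 0 xE OE0 x2) => //; ring. Qed.

(** * Finiteness of O/2O and its consequences *)

Fixpoint subset_sums (s : seq L) : seq L :=
  if s is x :: s' then subset_sums s' ++ map (+%R x) (subset_sums s')
  else [:: 0].

(** This is the F_2-span of [s] modulo 2O: subset sums are the combinations with coefficients 0 and
    1, and integrality of half the difference is congruence modulo 2O. *)
Definition sums_cover (s : seq L) (z : L) : Prop :=
  exists2 z', z' \in subset_sums s & OE ((z - z') / 2).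

(** Each coefficient is reduced modulo 2; its even part contributes only to 2O. *)
Lemma sums_cover_comb (s : seq L) (c : nat -> int) :
  (forall x, x \in s -> OE x) ->
  sums_cover s (\sum_(i < size s) (c i)%:~R * s`_i).
Proof.
elim: s c => [|x s IH] c sO /=.
  by exists 0; rewrite ?inE // big_ord0 subrr mul0r; exact: OE0.
have [|z' z'in z'O] := IH (fun i => c i.+1).
  by move=> y ys; apply: sO; rewrite inE ys orbT.
have xO : OE x by apply: sO; rewrite inE eqxx.
rewrite big_ord_recl /=; have n2 := ext_rat_neq0 1.
have [k [b ec]] : exists k : int, exists b : bool, c 0%N = 2 * k + b%:Z.
  exists (divz (c 0%N) 2), (modz (c 0%N) 2 == 1); case: eqP => /=; lia.
have O1 : OE (k%:~R * x + (\sum_(i < size s) (c i.+1)%:~R * s`_i - z') / 2).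
  by apply: OED => //; apply: OEM => //; exact: OE_int.
case: b ec => /= ec.
- exists (x + z'); first by rewrite mem_cat map_f ?orbT.
  by apply: (OE_eq _ _ O1); rewrite ec rmorphD rmorphM /=; field.
- exists z'; first by rewrite mem_cat z'in.
  by apply: (OE_eq _ _ O1); rewrite ec rmorphD rmorphM /=; field.
Qed.

(* No entry lies in the F_2-span, modulo 2O, of the entries after it. *)
Fixpoint mod2_free (s : seq L) : Prop :=
  if s is x :: s' then [/\ OE x, ~ sums_cover s' x & mod2_free s'] else True.

Lemma mod2_free_OE (s : seq L) x : mod2_free s -> x \in s -> OE x.
Proof. by elim: s => //= y s IH [yO _ /IH {}IH]; rewrite inE => /predU1P[->|]. Qed.

(** If the head coefficient were odd, the head would be congruent modulo 2O to an integer
    combination of the tail, hence covered by it. An even head term can be subtracted, which leaves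
    the same claim for the tail. *)
Lemma mod2_free_even (s : seq L) (c : nat -> int) :
  mod2_free s -> OE ((\sum_(i < size s) (c i)%:~R * s`_i) / 2) ->
  forall i, (i < size s)%N -> (2 %| c i)%Z.
Proof.
elim: s c => //= x s IH c [xO xn sf].
have sO := fun y => @mod2_free_OE s y sf; have n2 := ext_rat_neq0 1.
rewrite big_ord_recl /= => cO.
have c0 : (2 %| c 0%N)%Z.
  apply/idP/negPn/negP => c0; apply: xn.
  have [k ek] : exists k : int, c 0%N = 2 * k + 1 by exists (divz (c 0%N) 2); lia.
  have [z' z'in z'O] := sums_cover_comb s (fun i => - c i.+1) sO.
  have eS : \sum_(i < size s) (- c i.+1)%:~R * s`_i
      = - \sum_(i < size s) (c i.+1)%:~R * s`_i :> L.
    by rewrite -sumrN; apply: eq_bigr => i _; rewrite rmorphN mulNr.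
  rewrite {}eS in z'O; exists z' => //.
  apply: (OE_eq _ _ (OED _ _ (OEB _ _ cO (OEM _ _ (OE_int k) xO)) z'O)).
  by rewrite ek rmorphD rmorphM /=; field.
case=> [|i] // /(IH (fun i => c i.+1)); apply => //.
have /dvdzP[k ek] := c0.
apply: (OE_eq _ _ (OEB _ _ cO (OEM _ _ (OE_int k) xO))).
by rewrite ek rmorphM /=; field.
Qed.

(** Counting dimensions gives a rational relation; scaling it to a primitive integer vector leaves
    some coefficient odd. *)
Lemma integer_relation (s : seq L) : (\dim {: L} < size s)%N ->
  exists c : nat -> int, \sum_(i < size s) (c i)%:~R * s`_i = 0 /\
    exists2 i, (i < size s)%N & ~~ (2 %| c i)%Z.
Proof.
move=> ds.
have : ~~ free (in_tuple s).
  by rewrite /free neq_ltn (leq_ltn_trans _ ds) // dimvS ?subvf.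
move/freeP => nf.
have [k [ek [i0 ki0]]] : exists k : 'I_(size s) -> rat,
    \sum_(i < size s) k i *: (in_tuple s)`_i = 0 /\ exists i, k i <> 0.
  apply: NNPP => h; apply: nf => k ek i; apply: NNPP => ki; apply: h.
  by exists k; split=> //; exists i.
(* The coefficients are packed into a polynomial, so that a primitive part of it clears denominators
   and common factors at once. *)
pose p : {poly rat} := \poly_(i < size s) (if insub i is Some j then k j else 0).
have pE (i : 'I_(size s)) : p`_i = k i by rewrite coef_poly ltn_ord valK.
have [q [a a0 pq]] := rat_poly_scale p.
have q0 : q != 0.
  apply/eqP => q0; apply: ki0; rewrite -pE pq q0 rmorph0 scaler0 coef0 //.
have a0' : (a%:~R : rat) != 0 by rewrite intr_eq0.
have zc0 : ((zcontents q)%:~R : rat) != 0 by rewrite intr_eq0 zcontents_eq0.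
have prE (i : nat) : (((zprimitive q)`_i)%:~R : rat) = a%:~R / (zcontents q)%:~R * p`_i.
  have -> : p`_i = a%:~R^-1 * (zcontents q * (zprimitive q)`_i)%:~R.
    by rewrite pq coefZ coef_map /= {1}(zpolyEprim q) coefZ.
  rewrite intrM.
  by field; rewrite a0' zc0.
exists (fun i => (zprimitive q)`_i); split.
  transitivity ((a%:~R / (zcontents q)%:~R : rat) *: \sum_(i < size s) k i *: s`_i).
    rewrite scaler_sumr; apply: eq_bigr => i _.
    rewrite scalerA -pE -prE -(rmorph_int (in_alg L)) /= mulr_algl.
    by [].
  by rewrite ek scaler0.
apply: NNPP => h.
have : (2 %| zcontents (zprimitive q))%Z.
  rewrite dvdz_contents; apply/polyOverP => i.
  case: (ltnP i (size s)) => his.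
    by apply: NNPP => hi; apply: h; exists i => //; apply/negP.
  suff -> : (zprimitive q)`_i = 0 by rewrite dvdz0.
  have p0 : p`_i = 0 by rewrite coef_poly ltnNge his.
  have := prE i; rewrite p0 mulr0 => /eqP.
  by rewrite intr_eq0 => /eqP.
by rewrite zcontents_primitive q0.
Qed.

(** Without a finite list of representatives, a [mod2_free] list could always be extended, beyond
    the dimension of L. The integer relation then available has an odd coefficient, against
    [mod2_free_even]. *)
Lemma OE_mod2_finite : exists l : seq L,
  forall z, OE z -> exists2 z', z' \in l & OE ((z - z') / 2).
Proof.
apply: NNPP => nl.
have ext n : exists2 s, mod2_free s & size s = n.
  elim: n => [|n [s sf ss]]; first by exists [::].
  have [z [zO zn]] : exists z, OE z /\ ~ sums_cover s z.
    apply: NNPP => h; apply: nl; exists (subset_sums s) => z zO.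
    by apply: NNPP => hz; apply: h; exists z.
  by exists (z :: s); rewrite //= ss.
have [s sf ss] := ext (\dim {: L}).+1.
have [|c [c0 [i ils]]] := integer_relation s; first by rewrite ss.
move/negP; apply; apply: (mod2_free_even s c sf) ils.
by rewrite c0 mul0r; exact: OE0.
Qed.

Lemma OE_pigeonhole (f : nat -> L) : (forall n, OE (f n)) ->
  exists m n, (m < n)%N /\ OE ((f n - f m) / 2).
Proof.
move=> fO; have [l lP] := OE_mod2_finite.
have [|g gP] := @fin_all_exists 'I_(size l).+1 (fun=> L)
    (fun i z' => z' \in l /\ OE ((f i - z') / 2)).
  by move=> i; have [z' ? ?] := lP _ (fO i); exists z'.
have : ~~ injectiveb g.
  apply/negP => gi; have := @uniq_leq_size _ (codom g) l gi.
  rewrite size_codom card_ord ltnn => h; suff: false by [].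
  by apply: h => _ /codomP[i ->]; case: (gP i).
case/injectivePn => i [j ij gij].
wlog lij : i j ij gij / (i < j)%N.
  move=> W; case: (ltngtP i j) => [h|h|h]; first exact: (W i j).
    by apply: (W j i) => //; rewrite eq_sym.
  by move/eqP: ij; case; apply: val_inj.
exists i, j; split=> //.
have [_ iO] := gP i; have [_ jO] := gP j; have n2 := ext_rat_neq0 1.
by apply: (OE_eq _ _ (OEB _ _ jO iO)); rewrite gij; field.
Qed.

(** Two of the elements 2 y^n agree modulo 2O; halving their difference gives a monic equation y^n =
    y^m + h with h integral. *)
Lemma OE_almost_integral (y : L) : y \in E -> (forall n, OE (2 * y ^+ n)) -> OE y.
Proof.
move=> yE yO; have [m [n [mn h]]] := OE_pigeonhole _ yO.
have n2 := ext_rat_neq0 1.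
by apply: (OE_closed _ _ _ _ _ yE OE1 h mn); field.
Qed.

End IntegerRing.

(** * A prime P above 2: its powers, a local inverse, the ramification index *)

Section PrimeAboveTwo.
Variables (L : fieldExtType rat) (E : {subfield L}) (P : L -> Prop).
Hypotheses (Pprime : is_prime_ideal E P) (P2 : P 2).
Local Notation OE := (in_OE E).
Local Notation "P ^^ n" := (ideal_pow E P n) (at level 30).

Lemma prime_OE (x : L) : P x -> OE x.
Proof. by case: Pprime => -[h _] _; apply: h. Qed.

Lemma primeD (x y : L) : P x -> P y -> P (x + y).
Proof. by case: Pprime => -[_ [_ [h _]]] _; apply: h. Qed.

Lemma primeM (a x : L) : OE a -> P x -> P (a * x).
Proof. by case: Pprime => -[_ [_ [_ h]]] _; apply: h. Qed.

Lemma prime_not1 : ~ P 1.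
Proof. by case: Pprime => _ []. Qed.

Lemma primeM_or (a b : L) : OE a -> OE b -> P (a * b) -> P a \/ P b.
Proof. by case: Pprime => _ [_ h]; apply: h. Qed.

Lemma primeX (a : L) (n : nat) : OE a -> P (a ^+ n) -> P a.
Proof.
move=> aO; elim: n => [|n IH]; first by move/prime_not1.
by rewrite exprS => /(primeM_or _ _ aO (OEX _ _ _ n aO))[].
Qed.

Lemma prime_eq (x y : L) : P x -> x = y -> P y.
Proof. by move=> xP <-. Qed.

Lemma primeB (x y : L) : P x -> P y -> P (x - y).
Proof.
move=> xP yP; apply: (prime_eq (x + (-1)%:~R * y)); last by rewrite mulN1r.
by apply: primeD => //; apply: primeM => //; exact: OE_int.
Qed.

Lemma prime_odd (k : int) : ~ P (2 * k%:~R + 1).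
Proof.
move=> h; apply: prime_not1.
apply: (prime_eq _ _ (primeB _ _ h (primeM _ _ (OE_int L E k) P2))); ring.
Qed.

(** Two powers a^m and a^n with m < n agree modulo 2O, hence modulo P. Cancelling a^m, which is
    outside P, leaves a^(n-m) = 1 modulo P, so a power of a inverts a. *)
Lemma prime_inverse (a : L) : OE a -> ~ P a -> exists2 b, OE b & P (1 - b * a).
Proof.
move=> aO aP; have [m [n [mn h]]] := OE_pigeonhole _ _ _ (fun n => OEX _ _ a n aO).
have bO : OE (a ^+ (n - m.+1)) by exact: OEX.
exists (a ^+ (n - m.+1)) => //.
have uO := OEB _ _ _ _ (OE1 L E) (OEM _ _ _ _ bO aO).
have n2 := ext_rat_neq0 L 1.
have : P (a ^+ m * (1 - a ^+ (n - m.+1) * a)).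
  apply: (prime_eq ((-1)%:~R * ((a ^+ n - a ^+ m) / 2) * 2)).
    by apply: primeM => //; apply: OEM => //; exact: OE_int.
  have -> : n = (m + (n - m.+1).+1)%N by lia.
  rewrite exprD exprS; have -> : (m + (n - m.+1).+1 - m.+1 = n - m.+1)%N by lia.
  by field.
by case/(primeM_or _ _ (OEX _ _ _ m aO) uO) => // /primeX-/(_ aO).
Qed.

Lemma ideal_pow_ideal (n : nat) : is_ideal E (P ^^ n).
Proof.
elim: n => [|n [IO [I0 [ID IM]]]] /=.
  split=> //; split; first exact: OE0.
  by split; [exact: OED | exact: OEM].
split=> [x [s [sP ->]]|]; [|split; [|split]].
- elim: s sP => [|ab s IH] sP; first by rewrite big_nil; exact: OE0.
  rewrite big_cons; apply: OED.
    have [aP bI] := sP ab (mem_head _ _).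
    by apply: OEM; [exact: prime_OE | exact: IO].
  by apply: IH => cd cds; apply: sP; rewrite inE cds orbT.
- by exists [::]; rewrite big_nil.
- move=> x y [s [sP ->]] [t [tP ->]]; exists (s ++ t); rewrite big_cat /=.
  by split=> // ab; rewrite mem_cat => /orP[/sP|/tP].
move=> a x aO [s [sP ->]]; exists [seq (a * ab.1, ab.2) | ab <- s]; split.
  by move=> _ /mapP[ab /sP[? ?] ->]; split=> //=; exact: primeM.
by rewrite big_map mulr_sumr; apply: eq_bigr => ab _; rewrite mulrA.
Qed.

Lemma ideal_pow_OE (n : nat) (x : L) : (P ^^ n) x -> OE x.
Proof. by case: (ideal_pow_ideal n) => h _; apply: h. Qed.

Lemma ideal_powD (n : nat) (x y : L) : (P ^^ n) x -> (P ^^ n) y -> (P ^^ n) (x + y).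
Proof. by case: (ideal_pow_ideal n) => _ [_ [h _]]; apply: h. Qed.

Lemma ideal_powM (n : nat) (a x : L) : OE a -> (P ^^ n) x -> (P ^^ n) (a * x).
Proof. by case: (ideal_pow_ideal n) => _ [_ [_ h]]; apply: h. Qed.

Lemma ideal_powS (n : nat) (a x : L) : P a -> (P ^^ n) x -> (P ^^ n.+1) (a * x).
Proof.
move=> aP xI; exists [:: (a, x)]; rewrite big_seq1; split=> //.
by move=> ab; rewrite inE => /eqP ->.
Qed.

Lemma ideal_powS_sub (n : nat) (x : L) : (P ^^ n.+1) x -> (P ^^ n) x.
Proof.
case=> s [sP ->]; elim: s sP => [|ab s IH] sP.
  by rewrite big_nil; case: (ideal_pow_ideal n) => _ [].
rewrite big_cons; apply: ideal_powD.
  by have [/prime_OE aP bI] := sP ab (mem_head _ _); exact: ideal_powM.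
by apply: IH => cd cds; apply: sP; rewrite inE cds orbT.
Qed.

(** With b inverse to a modulo P, z = (1 - b a) z + b (a z). The second summand is in P^n, and the
    first gains a factor in P over what induction gives for z. *)
Lemma ideal_pow_cancel (n : nat) (a z : L) :
  OE a -> ~ P a -> OE z -> (P ^^ n) (a * z) -> (P ^^ n) z.
Proof.
move=> aO aP zO; have [b bO bP] := prime_inverse a aO aP.
elim: n => [|n IH] // azI.
have -> : z = (1 - b * a) * z + b * (a * z) by ring.
apply: ideal_powD; last exact: ideal_powM.
by apply: ideal_powS => //; apply: IH; exact: ideal_powS_sub.
Qed.

(** The element y will be b / 2. Starting from 1, b is multiplied up while running through a finite
    list of representatives of O/2O; an element of P is congruent to one of them, which is again in
    P because 2 is. *)
Lemma prime_mod2_annihilator :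
  exists b, [/\ OE b, ~ OE (b / 2) & forall p, P p -> OE (b * p / 2)].
Proof.
have n2 := ext_rat_neq0 L 1.
have half_not s : OE s -> ~ P s -> ~ OE (s / 2).
  by move=> sO sP h; apply: sP; apply: (prime_eq _ _ (primeM _ _ h P2)); field.
(* [nz b]: the image of b in the localization of O/2O at P is nonzero.  Each
   p in P is nilpotent there, so multiplying b by a power of p (and by some s
   outside P) makes p annihilate it while keeping it nonzero. *)
pose nz b := forall s, OE s -> ~ P s -> ~ OE (b * s / 2).
have step b p : OE b -> nz b -> P p ->
    exists b', [/\ OE b', nz (b * b') & OE (b * b' * p / 2)].
  move=> bO bnz pP; have pO := prime_OE _ pP.
  have [m [n [mn h]]] := OE_pigeonhole _ _ _ (fun n => OEX _ _ p n pO).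
  (* Since p^m (1 - p^(n-m)) lies in 2O, a factor 1 - p^(n-m) outside P makes p^m vanish in the
     localization. *)
  have tP : ~ P (1 - p ^+ (n - m)).
    move=> h1; apply: prime_not1.
    apply: (prime_eq _ _ (primeD _ _ h1 (_ : P (p ^+ (n - m))))); last by ring.
    have k0 : (0 < n - m)%N by rewrite subn_gt0.
    rewrite -(prednK k0) exprSr; apply: primeM => //; exact: OEX.
  have tO : OE (1 - p ^+ (n - m)) by apply: OEB; [exact: OE1 | exact: OEX].
  have zm : ~ nz (b * p ^+ m).
    move=> /(_ _ tO tP); apply.
    apply: (OE_eq _ _ _ _ (OEM _ _ _ _ (OEM _ _ _ _ (OE_int L E (-1)) bO) h)).
    by rewrite -{1}(subnKC (ltnW mn)) exprD; field.
  (* Descend to an exponent m with b p^m locally nonzero but b p^(m+1) killed by some s outside P;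
     then b' = p^m s. *)
  elim: m {mn h tP tO} zm => [|m IH] zm; first by case: zm; rewrite expr0 mulr1.
  case: (classic (nz (b * p ^+ m))) => [nzm|]; last exact: IH.
  have [s [sO sP hs]] : exists s, [/\ OE s, ~ P s & OE (b * p ^+ m.+1 * s / 2)].
    apply: NNPP => hn; apply: zm => s sO sP hs; apply: hn.
    by exists s.
  exists (p ^+ m * s); split; first by apply: OEM => //; exact: OEX.
    move=> u uO uP hu; apply: (nzm (s * u)).
    - exact: OEM.
    - by case/(primeM_or _ _ sO uO).
    by apply: (OE_eq _ _ _ _ hu); ring.
  by apply: (OE_eq _ _ _ _ hs); rewrite exprS; field.
have iter (l : seq L) : exists b, [/\ OE b, nz b &
    forall p, p \in l -> P p -> OE (b * p / 2)].
  elim: l => [|p l [b [bO bnz bl]]].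
    by exists 1; split=> //; [exact: OE1 | move=> s; rewrite mul1r; exact: half_not].
  case: (classic (P p)) => [pP|npP]; last first.
    by exists b; split=> // q; rewrite inE => /predU1P[-> //|]; exact: bl.
  have [b' [b'O b'nz b'p]] := step b p bO bnz pP.
  exists (b * b'); split=> //; first exact: OEM.
  move=> q; rewrite inE => /predU1P[-> //|/bl h /h hq].
  by apply: (OE_eq _ _ _ _ (OEM _ _ _ _ b'O hq)); field.
have [l lP] := OE_mod2_finite L E.
have [b [bO bnz bl]] := iter l.
exists b; split=> //.
  by move=> h; apply: (bnz 1 (OE1 L E) prime_not1); rewrite mulr1.
move=> p pP; have [q ql qO] := lP p (prime_OE _ pP).
have qP : P q.
  by apply: (prime_eq _ _ (primeB _ _ pP (primeM _ _ qO P2))); field.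
by apply: (OE_eq _ _ _ _ (OED _ _ _ _ (OEM _ _ _ _ bO qO) (bl q ql qP))); field.
Qed.

(** If multiplication by y = b / 2 mapped P into itself, every 2 y^n would stay in P, and y would be
    integral by [OE_almost_integral]. *)
Lemma prime_local_inverse :
  exists y pi, [/\ y \in E, ~ OE y, forall p, P p -> OE (y * p), P pi & ~ P (y * pi)].
Proof.
have n2 := ext_rat_neq0 L 1.
have [b [bO b2 bP]] := prime_mod2_annihilator.
have yE : b / 2 \in E.
  by case/in_OEP: bO => bE _; rewrite rpred_div ?rpred_nat.
have yP p : P p -> OE (b / 2 * p).
  by move=> /bP h; apply: (OE_eq _ _ _ _ h); field.
exists (b / 2); apply: NNPP => hn; apply: (b2); apply: OE_almost_integral => // n.
have hP p : P p -> P (b / 2 * p).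
  by move=> pP; apply: NNPP => h; apply: hn; exists p; split.
apply: prime_OE; elim: n => [|n IH]; first by rewrite expr0 mulr1.
by apply: (prime_eq _ _ (hP _ IH)); rewrite exprS; ring.
Qed.

Lemma even_ram_index_2 (x a : L) : OE x -> OE a -> ~ P a -> x ^+ 2 = 2 * a ->
  exists e : nat, ram_index_2 E P e /\ (2 %| e)%N.
Proof.
move=> xO aO aP xa; have [y [pi [yE yO yP piP uP]]] := prime_local_inverse.
have piO := prime_OE _ piP; have uO := yP _ piP.
(* Exponents j below n are allowed because the parity argument uses 2 y^(2k) as well as 2 y^e. *)
have pow_y n j z : (P ^^ n) z -> (j <= n)%N -> OE (z * y ^+ j).
  elim: n j z => [|n IH] [|j] z //; rewrite ?expr0 ?mulr1.
  - by move=> /ideal_pow_OE.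
  - by move=> /ideal_pow_OE.
  case=> s [sP ->] jn; elim: s sP => [|ab s IHs] sP.
    by rewrite big_nil mul0r; exact: OE0.
  rewrite big_cons mulrDl; apply: OED; last first.
    by apply: IHs => cd cds; apply: sP; rewrite inE cds orbT.
  have [h1 h2] := sP ab (mem_head _ _).
  by apply: (OE_eq _ _ _ _ (OEM _ _ _ _ (yP _ h1) (IH j _ h2 jn))); rewrite exprS; ring.
(* The factor (y pi)^n is outside P and can be cancelled, while (y pi)^n z = pi^n (z y^n) is visibly
   in P^n. *)
have y_pow n z : OE z -> OE (z * y ^+ n) -> (P ^^ n) z.
  move=> zO zyO; apply: (ideal_pow_cancel n ((y * pi) ^+ n)) => //; first exact: OEX.
    by move=> /(primeX _ _ uO).
  have -> : (y * pi) ^+ n * z = pi ^+ n * (z * y ^+ n) by rewrite exprMn; ring.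
  elim: n (z * y ^+ n) zyO => [|n IH] o oO; first by rewrite expr0 mul1r.
  by rewrite exprS -mulrA; apply: ideal_powS => //; exact: IH.
(* Otherwise 2 would lie in every P^n, all 2 y^n would be integral, and so would y. *)
have [e [eI eNI]] : exists e, ram_index_2 E P e.
  apply: NNPP => hn; apply: yO; apply: OE_almost_integral => // n.
  apply: (pow_y n) => //; elim: n => [|n IH]; first exact: (OE_int L E 2).
  by apply: NNPP => h; apply: hn; exists n.
exists e; split=> //; apply/negPn/negP => e_odd; apply: eNI.
have [k ek] : exists k, e = k.*2.+1 by exists e./2; lia.
have ke : (k.*2 <= e)%N by rewrite ek.
have eE : y ^+ e = y ^+ k ^+ 2 * y by rewrite ek exprSr -muln2 exprM.
have xE : x \in E by case/in_OEP: xO.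
(* For e = 2k + 1 this w would have valuation 1/2. Its square 2 a y^(2k) is integral, so w is; and
   w^2 y = 2 a y^e is integral, which forces w into P since y pi is outside P. *)
pose w := x * y ^+ k.
have wO : OE w.
  apply: OE_sqr; first by rewrite rpredM ?rpredX.
  apply: (OE_eq _ _ _ _ (OEM _ _ _ _ aO (pow_y e k.*2 2 eI ke))).
  by rewrite exprMn xa -muln2 exprM; ring.
have wP : P w.
  apply: (primeX w 2) => //.
  have w2O : OE (w ^+ 2) by exact: OEX.
  suff: P (w ^+ 2 * (y * pi)) by case/(primeM_or _ _ w2O uO).
  apply: (prime_eq _ _ (primeM _ _ (OEM _ _ _ _ aO (pow_y e e 2 eI (leqnn e))) piP)).
  by rewrite exprMn xa eE; ring.
(* Now w y is integral and its square is 2 a y^(e+1), so a 2, and hence 2, lies in P^(e+1). *)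
apply: (ideal_pow_cancel _ a) => //; first exact: (OE_int L E 2).
apply: y_pow; first by apply: OEM => //; exact: (OE_int L E 2).
apply: (OE_eq _ _ _ _ (OEX _ _ _ 2 (yP _ wP))).
by rewrite [y ^+ e.+1]exprSr eE exprMn /w exprMn xa; ring.
Qed.

End PrimeAboveTwo.

(** * Roots of the second iterate and the cases modulo 4 *)

(** Up to a unit, q is a subproduct of the linear factors, and it is not the empty one. *)
Lemma dvdp_split_root (F : fieldType) (p q : {poly F}) (rs : seq F) :
  p %= \prod_(z <- rs) ('X - z%:P) -> q %| p -> size q != 1 ->
  exists2 z, z \in rs & root q z.
Proof.
move=> prs; rewrite (eqp_dvdr _ prs) => /dvdp_prod_XsubC[m qm] q1.
case: (mask m rs) (fun x => @mem_mask _ x m rs) qm => [|z t] zin qm.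
  by move: qm q1; rewrite big_nil -size_poly_eq1 => /eqP ->.
exists z; first by apply: zin; rewrite mem_head.
by rewrite (eqp_root qm) root_prod_XsubC mem_head.
Qed.

(** Any root al defines r = al^2 + c. As c = -r^2, the polynomial is a difference of squares, (X^2 +
    c - r)(X^2 + c + r), and be is a root of the second factor. *)
Lemma fc2_splitting_roots (c : int) (L : fieldExtType rat) (E : {subfield L}) :
  splittingFieldFor 1%VS (map_poly (in_alg L) (fc2 c)) E ->
  exists al be r : L, [/\ al \in E, be \in E, r ^+ 2 = - c%:~R,
    al ^+ 2 = - c%:~R + r & be ^+ 2 = - c%:~R - r].
Proof.
case=> rs prs EE; have inE z : z \in rs -> z \in E.
  by move=> zrs; rewrite -EE seqv_sub_adjoin.
have pE : map_poly (in_alg L) (fc2 c) = ('X^2 + c%:~R%:P) ^+ 2 + c%:~R%:P.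
  rewrite /fc2 map_comp_poly /fc rmorphD /= map_polyXn map_polyC /=.
  by rewrite scaler_int comp_polyD comp_Xn_poly comp_polyC.
have size2 (z : L) : size ('X^2 + z%:P) = 3 by rewrite size_XnaddC.
have size4 : size (map_poly (in_alg L) (fc2 c)) != 1.
  rewrite size_map_poly; have := size_comp_poly (fc c) (fc c).
  by rewrite /fc !size_XnaddC //= -/(fc c) -/(fc2 c); case: size => [|[]].
have [al al_rs] := dvdp_split_root _ _ _ _ prs (dvdpp _) size4.
rewrite pE rootE !hornerE => /eqP al_root.
have [r [r2 al2]] : exists r, r ^+ 2 = - c%:~R /\ al ^+ 2 = - c%:~R + r.
  exists (al ^+ 2 + c%:~R); split; last by ring.
  by apply/eqP; rewrite -subr_eq0 opprK; apply/eqP.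
have [||be be_rs] := dvdp_split_root _ _ ('X^2 + (c%:~R + r)%:P) _ prs.
- rewrite pE; apply/dvdpP; exists ('X^2 + (c%:~R - r)%:P).
  have -> : c%:~R%:P = - (r%:P ^+ 2) :> {poly L} by rewrite -rmorphXn r2 rmorphN opprK.
  rewrite !rmorphD rmorphN /=.
  have -> : c%:~R%:P = - (r%:P ^+ 2) :> {poly L} by rewrite -rmorphXn r2 rmorphN opprK.
  by ring.
- by rewrite size2.
rewrite rootE !hornerE => /eqP be_root.
exists al, be, r; split; [exact: inE | exact: inE | by [] | by [] |].
have {}be_root : be ^+ 2 + c%:~R + r = 0 by [].
by apply/eqP; rewrite -subr_eq0 -be_root; apply/eqP; ring.
Qed.

Theorem theorem1p1 (c : int) (L : fieldExtType rat) (E : {subfield L}) :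
  c != 0 ->
  splittingFieldFor 1%VS (map_poly (in_alg L) (fc2 c)) E ->
  forall P : L -> Prop, is_prime_ideal E P -> P 2 ->
  exists e : nat, ram_index_2 E P e /\ (2 %| e)%N.
Proof.
move=> c0 split P Pprime P2.
have [al [be [r [alE beE r2 al2 be2]]]] := fc2_splitting_roots _ _ _ split.
pose d : int := - c; have d0 : d != 0 by rewrite oppr_eq0.
have dE : - c%:~R = d%:~R :> L by rewrite rmorphN.
rewrite dE in r2 al2 be2.
have intO := OE_int L E.
have rO : in_OE E r.
  have rE : r \in E.
    have -> : r = al ^+ 2 - d%:~R by rewrite al2; ring.
    by rewrite rpredB ?rpredX ?rpred_int.
  by apply: OE_sqr; rewrite ?r2.
have alO : in_OE E al by apply: OE_sqr; rewrite // al2; apply: OED.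
have beO : in_OE E be by apply: OE_sqr; rewrite // be2; apply: OEB.
have n2 := ext_rat_neq0 L 1.
have odd_notP := prime_odd L E P Pprime P2.
have three_mod4 (t : L) (j : int) : in_OE E t -> t ^+ 2 = 4 * j%:~R + 3 ->
    exists e : nat, ram_index_2 E P e /\ (2 %| e)%N.
  move=> tO t2; have jO := OEM _ _ _ _ (intO 2) (intO (j + 1)).
  apply: (even_ram_index_2 _ _ _ Pprime P2 (1 + t) (2 * (j + 1)%:~R + t)).
  - by apply: OED => //; exact: OE1.
  - exact: OED.
  (* If t were in P, so would be t^2 = 2 (2j + 1) + 1, which is odd. *)
  - move=> h; have tP : P t.
      apply: (prime_eq _ _ _ _ (primeB _ _ _ Pprime _ _ h
        (primeM _ _ _ Pprime _ _ (intO (j + 1)) P2))); ring.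
    apply: (odd_notP (2 * j + 1)).
    apply: (prime_eq _ _ _ _ (primeM _ _ _ Pprime _ _ tO tP)).
    by rewrite -expr2 t2 !rmorphD rmorphM /=; ring.
  have -> : (1 + t) ^+ 2 = 1 + 2 * t + t ^+ 2 by ring.
  by rewrite t2 rmorphD /=; ring.
have [j [dj|[dj|[dj|dj]]]] : exists j : int,
    d = 4 * j \/ d = 4 * j + 1 \/ d = 4 * j + 2 \/ d = 4 * j + 3.
  by exists (divz d 4); lia.
(* Here c != 0 allows division by r: (al be)^2 = d^2 - r^2 and r^2 = d give t^2 = d - 1 = 4 (j - 1)
   + 3. *)
- have r0 : r != 0.
    apply: contra_neq d0 => r0; move/eqP: r2.
    by rewrite r0 expr0n eq_sym -(rmorph_int (in_alg L)) fmorph_eq0 intr_eq0 => /eqP.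
  have t2 : (al * be / r) ^+ 2 = 4 * (j - 1)%:~R + 3.
    rewrite expr_div_n exprMn al2 be2.
    have -> : (d%:~R + r) * (d%:~R - r) = d%:~R ^+ 2 - r ^+ 2 by ring.
    have -> : d%:~R = r ^+ 2 by rewrite r2.
    rewrite rmorphB /=; transitivity (r ^+ 2 - 1); first by field.
    by rewrite r2 dj rmorphM /=; ring.
  apply: (three_mod4 _ _ _ t2); apply: OE_sqr.
    by case/in_OEP: rO => rE _; rewrite rpred_div ?rpredM.
  by rewrite t2; apply: OED (intO 3); apply: OEM (intO 4) _; exact: intO.
- pose w := (1 + r) / 2.
  have wE : w \in E.
    by case/in_OEP: rO => rE _; rewrite rpred_div ?rpred_nat // rpredD ?rpred1.
  have w2 : w ^+ 2 = 1 * w ^+ 1 + j%:~R.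
    transitivity (w + (r ^+ 2 - 1) / 2 / 2); first by rewrite /w; field.
    by rewrite r2 dj rmorphD rmorphM /=; field.
  have wO : in_OE E w by apply: (OE_closed _ _ _ _ _ _ _ wE (OE1 L E) (intO j) _ w2).
  have rw : r = 2 * w - 1 by rewrite /w; field.
  (* Use be when w is in P, since 1 - w + 2 j in P would then put 1 + 2 j in P; otherwise use al. *)
  case: (classic (P w)) => wP.
  + apply: (even_ram_index_2 _ _ _ Pprime P2 be (1 - w + 2 * j%:~R)) => //.
    * apply: OED; [by apply: OEB => //; exact: OE1 | exact: OEM (intO 2) (intO j)].
    * move=> h; apply: (odd_notP j).
      by apply: (prime_eq _ _ _ _ (primeD _ _ _ Pprime _ _ h wP)); ring.
    by rewrite be2 rw dj rmorphD rmorphM /=; ring.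
  + apply: (even_ram_index_2 _ _ _ Pprime P2 al (w + 2 * j%:~R)) => //.
    * by apply: OED => //; exact: OEM (intO 2) (intO j).
    * move=> h; apply: wP.
      apply: (prime_eq _ _ _ _ (primeB _ _ _ Pprime _ _ h
        (primeM _ _ _ Pprime _ _ (intO j) P2))); ring.
    by rewrite al2 rw dj rmorphD rmorphM /=; ring.
- apply: (even_ram_index_2 _ _ _ Pprime P2 r (2 * j%:~R + 1)) => //.
  + by apply: OED (OE1 L E); exact: OEM (intO 2) (intO j).
  by rewrite r2 dj rmorphD rmorphM /=; ring.
- by apply: (three_mod4 r j) => //; rewrite r2 dj rmorphD rmorphM.
Qed.
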